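(* Let $\mathbf d=(\mathbf a,\mathbf b)$ be a bidegree sequence with $\mathbf a=(a_1,\dots,a_N)$, $\mathbf b=(b_1,\dots,b_N)$, and let $i\neq j$ be two indices with $a_j\le a_i$. For $k\ge 0$ define the set of bidegree sequences $$X_k=X_k(i,j;\mathbf d)=\Big\{(\mathbf a-a_i\mathbf e_i-a_j\mathbf e_j,\ \mathbf b-\mathbf s):\ \mathbf s\in\{0,1,2\}^N,\ \#\{n:s_n=2\}=k,\ \textstyle\sum_{n=1}^N s_n=a_i+a_j\Big\}.$$ Then $$\|G_{\mathbf d}\|=\sum_{k=0}^{a_j}\binom{a_i+a_j-2k}{a_j-k}\,\|G_{X_k}\|.$$
   Context: A bidegree sequence is a pair $\mathbf d=(\mathbf a,\mathbf b)$ of integer vectors in $\mathbb Z^N$; $\mathbf a$ lists in-degrees and $\mathbf b$ out-degrees. $\|G_{\mathbf d}\|$ denotes the number of directed graphs on the vertex set $\{1,\dots,N\}$ in which every ordered pair $(u,v)$, including $u=v$ (loops), carries at most one edge, and node $n$ has in-degree $a_n$ and out-degree $b_n$ for all $n$; equivalently, the number of $N\times N$ $0$-$1$ matrices with row sums $a_1,\dots,a_N$ and column sums $b_1,\dots,b_N$. If $\mathbf d$ has a negative entry, $\|G_{\mathbf d}\|=0$. For a set $X$ of bidegree sequences, $\|G_X\|=\sum_{\mathbf r\in X}\|G_{\mathbf r}\|$. $\mathbf e_k$ is the $k$-th standard unit vector of $\mathbb Z^N$. *)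

(* Defs.v *)
From mathcomp Require Import all_boot all_order all_algebra.
From mathcomp Require Import finmap.

Set Implicit Arguments.
Unset Strict Implicit.
Unset Printing Implicit Defensive.

Import Order.TTheory GRing.Theory Num.Theory.
Local Open Scope fset_scope.
Local Open Scope ring_scope.

(* (a, b) with a the in-degrees and b the out-degrees; entries may be
   negative. *)
Definition bidegree (N : nat) : choiceType := ('rV[int]_N * 'rV[int]_N)%type.

(* A directed graph is its edge set, (u, v) being the edge from u to v;
   loops (u, u) are allowed. *)
Definition digraph (N : nat) : finType := {set 'I_N * 'I_N}.

Definition indeg N (G : digraph N) (n : 'I_N) : nat :=
  #|[set u | (u, n) \in (G : {set _})]|.

Definition outdeg N (G : digraph N) (n : 'I_N) : nat :=
  #|[set v | (n, v) \in (G : {set _})]|.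

Definition realizes N (d : bidegree N) (G : digraph N) : bool :=
  [forall n, ((indeg G n)%:Z == d.1 0 n) && ((outdeg G n)%:Z == d.2 0 n)].

(* ||G_d||. It is 0 when d has a negative entry, the degrees of a graph being
   natural numbers. *)
Definition num_graphs N (d : bidegree N) : nat :=
  #|[set G : digraph N | realizes d G]|.

(* ||G_X||; enumerating a finite set lists each element once. *)
Definition num_graphs_set N (X : {fset bidegree N}) : nat :=
  (\sum_(r <- X) num_graphs r)%N.

(* A vector of {0,1,2}^N is a row vector over 'I_3; this is its image in Z^N. *)
Definition int_vec N (s : 'rV['I_3]_N) : 'rV[int]_N :=
  \row_n (s 0 n : nat)%:Z.

Definition X_set N (i j : 'I_N) (d : bidegree N) (k : nat)
    : {fset bidegree N} :=
  let: (a, b) := d in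
  [fset ((a - a 0 i *: delta_mx 0 i - a 0 j *: delta_mx 0 j,
          b - int_vec s) : bidegree N)
   | s : 'rV['I_3]_N &
       (#|[set n | (s 0 n : nat) == 2%N]| == k)
       && (\sum_n int_vec s 0 n == a 0 i + a 0 j)].

(* Main.v *)
(* Delete from a graph all edges into i and j, and let s_n in {0,1,2} count the
   deleted edges leaving n. What remains realizes the degree sequence of X_k
   attached to s, where k is the number of 2s in s. Conversely, a graph with
   that degree sequence extends to one realizing (a, b) by choosing which of the
   a_i + a_j - 2k nodes with s_n = 1 point to j: these must be a_j - k in number,
   and the others then point to i, giving it in-degree a_i. *)

Require Import Defs.
From mathcomp Require Import all_boot all_order all_algebra.
From mathcomp Require Import finmap.
From mathcomp Require Import zify.

Set Implicit Arguments.
Unset Strict Implicit.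
Unset Printing Implicit Defensive.

Import Order.TTheory GRing.Theory Num.Theory.
Local Open Scope ring_scope.

(** * Deleting and reinserting the edges into [i] and [j] *)

Definition delete_heads N (i j : 'I_N) (G : digraph N) : digraph N :=
  [set e in (G : {set _}) | (e.2 != i) && (e.2 != j)].

(** Each value is at most 2, so [inord] never falls back on its default. *)
Definition tail_mult N (i j : 'I_N) (G : digraph N) : 'rV['I_3]_N :=
  \row_n inord (((n, i) \in (G : {set _})) + ((n, j) \in (G : {set _}))).

Definition tails_only N (i j : 'I_N) (G : digraph N) : {set 'I_N} :=
  [set n | ((n, j) \in (G : {set _})) && ((n, i) \notin (G : {set _}))].

Definition level N (s : 'rV['I_3]_N) (t : nat) : {set 'I_N} :=
  [set n | (s 0 n : nat) == t].

(** For fixed [s], the candidate inverse of [G] |-> ([delete_heads i j G], [tails_only i j G]): the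
    second component of [p] is the set of nodes of multiplicity 1 that are assigned to [j]. *)
Definition insert_heads N (i j : 'I_N) (s : 'rV['I_3]_N)
    (p : digraph N * {set 'I_N}) : digraph N :=
  [set e | if e.2 == i then (e.1 \in level s 2) || (e.1 \in level s 1 :\: p.2)
           else if e.2 == j then (e.1 \in level s 2) || (e.1 \in p.2)
           else e \in (p.1 : {set _})].

(** The member of [X_set] indexed by [s]. *)
Definition residual N (a b : 'rV[int]_N) (i j : 'I_N) (s : 'rV['I_3]_N) :
    bidegree N :=
  (a - a 0 i *: delta_mx 0 i - a 0 j *: delta_mx 0 j, b - int_vec s).

(** * Degrees before and after deletion *)

Lemma card_set_sum (T : finType) (P : pred T) :
  #|[set x | P x]| = (\sum_x P x)%N.
Proof. by rewrite -sum1dep_card big_mkcond; apply: eq_bigr => x _; case: ifP. Qed.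

Lemma indegE N (G : digraph N) n :
  indeg G n = (\sum_u ((u, n) \in (G : {set _})))%N.
Proof. exact: card_set_sum. Qed.

Lemma outdegE N (G : digraph N) n :
  outdeg G n = (\sum_v ((n, v) \in (G : {set _})))%N.
Proof. exact: card_set_sum. Qed.

Lemma tail_multE N (i j : 'I_N) (G : digraph N) n :
  tail_mult i j G 0 n =
  (((n, i) \in (G : {set _})) + ((n, j) \in (G : {set _})))%N :> nat.
Proof. by rewrite mxE inordK //; do 2!case: (_ \in _). Qed.

Lemma indeg_delete_heads N (i j : 'I_N) (G : digraph N) n :
  indeg (delete_heads i j G) n = if (n == i) || (n == j) then 0%N else indeg G n.
Proof.
rewrite !indegE; case: ifPn => [|nij].
  by move=> nij; apply: big1 => u _; rewrite inE /= -negb_or nij andbF.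
by apply: eq_bigr => u _; rewrite inE /= -negb_or nij andbT.
Qed.

Lemma outdeg_delete_heads N (i j : 'I_N) (G : digraph N) n : i != j ->
  outdeg G n = (outdeg (delete_heads i j G) n + tail_mult i j G 0%R n)%N.
Proof.
move=> ij; have ji : j != i by rewrite eq_sym.
rewrite tail_multE !outdegE (bigD1 i) //= (bigD1 j) //=.
rewrite [in RHS](bigD1 i) //= [in RHS](bigD1 j) //= !inE /= !eqxx !andbF /= !add0n.
rewrite addnA [RHS]addnC; congr (_ + _)%N; apply: eq_bigr => v /andP[vi vj].
by rewrite inE /= vi vj !andbT.
Qed.

Lemma sum_tail_mult N (i j : 'I_N) (G : digraph N) :
  \sum_n int_vec (tail_mult i j G) 0 n = (indeg G i)%:Z + (indeg G j)%:Z.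
Proof.
rewrite !indegE -PoszD -big_split /= -natz natr_sum; apply: eq_bigr => n _.
by rewrite mxE tail_multE natz.
Qed.

Lemma sum_int_vec N (s : 'rV['I_3]_N) :
  \sum_n int_vec s 0 n = (#|level s 1| + 2 * #|level s 2|)%:Z.
Proof.
rewrite !card_set_sum big_distrr -big_split /= -natz natr_sum.
by apply: eq_bigr => n _; rewrite mxE natz; case: (s 0 n) => -[|[|[|]]].
Qed.

(** A node pointing to [j] either points to [i] as well, and has multiplicity 2, or lies in
    [tails_only]. *)
Lemma indeg_tail_mult N (i j : 'I_N) (G : digraph N) :
  indeg G j = (#|level (tail_mult i j G) 2| + #|tails_only i j G|)%N.
Proof.
rewrite indegE !card_set_sum -big_split; apply: eq_bigr => n _ /=.
by rewrite tail_multE; do 2!case: (_ \in _).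
Qed.

Lemma tails_only_sub N (i j : 'I_N) (G : digraph N) :
  tails_only i j G \subset level (tail_mult i j G) 1.
Proof.
by apply/subsetP => n; rewrite !inE tail_multE; do 2!case: (_ \in _).
Qed.

Lemma realizes_residualP N (a b : 'rV[int]_N) (i j : 'I_N)
    (s : 'rV['I_3]_N) (G : digraph N) :
  i != j ->
  reflect (forall n,
      (indeg G n)%:Z = (if (n == i) || (n == j) then 0 else a 0 n) /\
      (outdeg G n)%:Z = b 0 n - (s 0 n : nat)%:Z)
    (realizes (residual a b i j s) G).
Proof.
move=> ij.
have aE n : (a - a 0 i *: delta_mx 0 i - a 0 j *: delta_mx 0 j) 0 n =
    if (n == i) || (n == j) then 0 else a 0 n.
  rewrite !mxE eqxx /=.
  case: (eqVneq n i) => [->|_]; first by rewrite (negPf ij) mulr1 mulr0 subr0 subrr.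
  case: (eqVneq n j) => [->|_]; first by rewrite mulr1 mulr0 subr0 subrr.
  by rewrite !mulr0 !subr0.
have bE n : (b - int_vec s) 0 n = b 0 n - (s 0 n : nat)%:Z by rewrite !mxE.
apply: (iffP forallP) => rG n; have /= := rG n; rewrite aE bE.
  by case/andP => /eqP -> /eqP ->.
by case=> -> ->; rewrite !eqxx.
Qed.

(** The out-degree conditions carry over because [tail_mult] records exactly the deleted edges.
    Deletion forgets the in-degrees of [i] and [j], which are therefore required separately. *)
Lemma realizes_delete_heads N (a b : 'rV[int]_N) (i j : 'I_N) (G : digraph N) :
  i != j ->
  realizes (a, b) G =
  [&& realizes (residual a b i j (tail_mult i j G)) (delete_heads i j G),
      (indeg G i)%:Z == a 0 i & (indeg G j)%:Z == a 0 j].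
Proof.
move=> ij.
apply/forallP/and3P => [rG | [/(realizes_residualP _ _ _ _ ij) rD /eqP ai /eqP aj] n].
  split; [|by case/andP: (rG i)|by case/andP: (rG j)].
  apply/(realizes_residualP _ _ _ _ ij) => n; have /andP[/eqP /= an /eqP /= bn] := rG n.
  rewrite indeg_delete_heads -an -bn (outdeg_delete_heads G n ij) PoszD addrK.
  by split=> //; case: ifP.
have [] := rD n; rewrite indeg_delete_heads => an bn.
rewrite /= (outdeg_delete_heads G n ij) PoszD bn subrK eqxx andbT.
move: an; case: (eqVneq n i) => [->|_]; first by rewrite ai.
by case: (eqVneq n j) => [->|_]; [rewrite aj|move=> /= ->].
Qed.

Lemma realizes_residual_heads N (a b : 'rV[int]_N) (i j : 'I_N)
    (s : 'rV['I_3]_N) (G : digraph N) n u :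
  i != j -> realizes (residual a b i j s) G -> (n == i) || (n == j) ->
  (u, n) \notin (G : {set _}).
Proof.
move=> ij /(realizes_residualP _ _ _ _ ij)/(_ n)[+ _] nij; rewrite nij => -[].
by move/eqP; rewrite cards_eq0 => /eqP/setP/(_ u); rewrite !inE => ->.
Qed.

(** * Deletion and insertion as mutually inverse maps *)

Lemma insert_headsK N (i j : 'I_N) (s : 'rV['I_3]_N) (G : digraph N) :
  tail_mult i j G = s ->
  insert_heads i j s (delete_heads i j G, tails_only i j G) = G.
Proof.
move=> <-; apply/setP => -[u v]; rewrite !inE /= !tail_multE.
case: (eqVneq v i) => [->|vi]; first by do 2!case: (_ \in _).
case: (eqVneq v j) => [->|vj]; first by do 2!case: (_ \in _).
by rewrite !andbT.
Qed.

Lemma tail_mult_insert_heads N (i j : 'I_N) (s : 'rV['I_3]_N)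
    (G : digraph N) (B : {set 'I_N}) :
  i != j -> B \subset level s 1 ->
  tail_mult i j (insert_heads i j s (G, B)) = s.
Proof.
move=> ij /subsetP sB; apply/rowP => n; apply: val_inj; rewrite /= tail_multE !inE /=.
rewrite !eqxx (eq_sym j) (negPf ij); move: (sB n); rewrite inE.
case: (n \in B) => [/(_ isT)/eqP -> //|_].
by case: (s 0 n) => -[|[|[|]]].
Qed.

Lemma tails_only_insert_heads N (i j : 'I_N) (s : 'rV['I_3]_N)
    (G : digraph N) (B : {set 'I_N}) :
  i != j -> B \subset level s 1 ->
  tails_only i j (insert_heads i j s (G, B)) = B.
Proof.
move=> ij /subsetP sB; apply/setP => n; rewrite !inE /=.
rewrite !eqxx (eq_sym j) (negPf ij); move: (sB n); rewrite inE.
case: (n \in B) => [/(_ isT)/eqP -> //|_].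
by case: (s 0 n) => -[|[|[|]]].
Qed.

Lemma delete_insert_heads N (i j : 'I_N) (s : 'rV['I_3]_N)
    (G : digraph N) (B : {set 'I_N}) :
  (forall n u, (n == i) || (n == j) -> (u, n) \notin (G : {set _})) ->
  delete_heads i j (insert_heads i j s (G, B)) = G.
Proof.
move=> G0; apply/setP => -[u v]; rewrite !inE /=; move: (G0 v u).
case: (eqVneq v i) => [->|vi] /=; first by move/(_ isT)/negPf->; rewrite andbF.
case: (eqVneq v j) => [->|vj] /=; first by move/(_ isT)/negPf->; rewrite andbF.
by rewrite andbT.
Qed.

(** [insert_heads i j s] is a bijection onto this set from the pairs of a residual graph and a
    subset of [level s 1] of size [a_j - #|level s 2|]; the bound on [level s 2] makes this size a
    true difference. *)
Lemma card_realizes_tail_mult N (a b : 'rV[int]_N) (i j : 'I_N) (s : 'rV['I_3]_N) :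
  i != j -> \sum_n int_vec s 0 n = a 0 i + a 0 j -> #|level s 2|%:Z <= a 0 j ->
  #|[set G | realizes (a, b) G && (tail_mult i j G == s)]| =
  ('C(absz (a 0 i + a 0 j - 2 * #|level s 2|%:Z)%R, absz (a 0 j - #|level s 2|%:Z)%R)
   * num_graphs (residual a b i j s))%N.
Proof.
move=> ij sum_s le2.
have level1 : absz (a 0 i + a 0 j - 2 * #|level s 2|%:Z)%R = #|level s 1|.
  by rewrite -sum_s sum_int_vec; lia.
rewrite level1 -cards_draws mulnC /num_graphs -cardsX.
set D := setX _ _; rewrite -(@card_in_imset _ _ (insert_heads i j s) D); last first.
  move=> [G B] [G' B'] /=; rewrite !inE /=.
  move=> /andP[rG /andP[sB _]] /andP[rG' /andP[sB' _]] e.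
  (* Both components of the pair can be read off the inserted graph. *)
  have Geq := congr1 (delete_heads i j) e; have Beq := congr1 (tails_only i j) e.
  move: Geq Beq; rewrite !tails_only_insert_heads // !delete_insert_heads.
  - by move=> -> ->.
  - by move=> n u; exact: (realizes_residual_heads u ij rG').
  - by move=> n u; exact: (realizes_residual_heads u ij rG).
apply: eq_card => G; apply/idP/imsetP => [|[[G' B]]].
  rewrite inE => /andP[+ /eqP tG].
  rewrite (realizes_delete_heads a b G ij) tG => /and3P[rG _ /eqP aj].
  exists (delete_heads i j G, tails_only i j G); last by rewrite insert_headsK.
  rewrite !inE /= rG -{1}tG tails_only_sub /=.
  by rewrite -aj (indeg_tail_mult i j G) tG PoszD addrC addKr.
rewrite !inE /= => /andP[rG /andP[sB cB]] ->.
rewrite tail_mult_insert_heads // eqxx andbT (realizes_delete_heads a b _ ij).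
rewrite tail_mult_insert_heads //.
rewrite delete_insert_heads; last by move=> n u; exact: (realizes_residual_heads u ij rG).
have aj : (indeg (insert_heads i j s (G', B)) j)%:Z = a 0 j.
  by rewrite (indeg_tail_mult i) tail_mult_insert_heads // tails_only_insert_heads // (eqP cB) PoszD gez0_abs ?subr_ge0 // addrC subrK.
(* The multiplicities sum to [a_i + a_j]; cancelling the in-degree of [j] leaves that of [i]. *)
have := sum_tail_mult i j (insert_heads i j s (G', B)).
rewrite tail_mult_insert_heads // sum_s aj => /addIr <-.
by rewrite rG !eqxx.
Qed.

(** * Summation over multiplicity vectors *)

Lemma num_graphs_X_set N (a b : 'rV[int]_N) (i j : 'I_N) k :
  num_graphs_set (X_set i j (a, b) k) =
  (\sum_(s | (#|level s 2| == k) && (\sum_n int_vec s 0 n == a 0 i + a 0 j)%R)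
     num_graphs (residual a b i j s))%N.
Proof.
rewrite /num_graphs_set /X_set big_imfset /=; first by rewrite big_filter big_enum_cond.
(* Distinct [s] give distinct [b - s], so passing to a set merges no terms. *)
move=> s t _ _ [/addrI/oppr_inj st]; apply/rowP => n; apply: val_inj.
by move/rowP/(_ n): st; rewrite !mxE => -[].
Qed.

(* a_j may be negative; the filter then makes the range 0 <= k <= a_j empty.
   For k in the range, both arguments of the binomial are nonnegative, so absz
   is just the conversion from int to nat. *)
Theorem theorem1 (N : nat) (a b : 'rV[int]_N) (i j : 'I_N) :
  i <> j ->
  a 0 j <= a 0 i ->
  num_graphs (a, b) =
  (\sum_(0 <= k < (absz (a 0%R j)).+1 | (k%:Z <= a 0 j)%R)
     'C(absz (a 0 i + a 0 j - 2 * k%:Z)%R, absz (a 0 j - k%:Z)%R)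
     * num_graphs_set (X_set i j (a, b) k))%N.
Proof.
move=> /eqP ij _.
(* [P] holds for the multiplicities of every realization: nodes of multiplicity 2 all point to [j],
   so there are at most [a_j] of them. *)
pose P (s : 'rV['I_3]_N) :=
  (\sum_n int_vec s 0 n == a 0 i + a 0 j) && (#|level s 2|%:Z <= a 0 j).
have tail_multP G : realizes (a, b) G -> P (tail_mult i j G).
  rewrite (realizes_delete_heads a b G ij) => /and3P[_ /eqP ai /eqP aj].
  by rewrite /P sum_tail_mult ai aj eqxx -aj (indeg_tail_mult i); lia.
rewrite {1}/num_graphs -sum1dep_card (partition_big _ P tail_multP) /=.
transitivity (\sum_(s | P s)
    ('C(absz (a 0 i + a 0 j - 2 * #|level s 2|%:Z)%R, absz (a 0 j - #|level s 2|%:Z)%R)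
     * num_graphs (residual a b i j s)))%N.
  apply: eq_bigr => s /andP[/eqP sum_s le2].
  by rewrite sum1dep_card card_realizes_tail_mult.
(* Group the vectors by their number of twos; it is at most [a_j], so [inord] preserves it. *)
rewrite big_mkord (partition_big (fun s => inord #|level s 2|)
  (fun k : 'I_(absz (a 0 j)).+1 => (k%:Z <= a 0 j))) /=; last first.
  move=> s /andP[_ le2]; rewrite inordK // ltnS -lez_nat gez0_abs //.
  exact: le_trans le2.
apply: eq_bigr => k lek; rewrite num_graphs_X_set big_distrr /=.
(* Once the number of twos is [k], the bound in [P] is just [lek]. *)
have Pk s : P s && (inord #|level s 2| == k) =
    (#|level s 2| == k) && (\sum_n int_vec s 0 n == a 0 i + a 0 j)%R.
  rewrite /P; case: (_ == a 0 i + a 0 j); rewrite /= ?andbF // andbT.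
  apply/andP/eqP => [[le2 /eqP <-]|e]; first by rewrite inordK //; lia.
  by rewrite e lek; split=> //; apply/eqP/val_inj; rewrite /= inordK.
by rewrite (eq_bigl _ _ Pk); apply: eq_bigr => s /andP[/eqP -> _].
Qed.
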